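(* For any topological spaces $X$ and $Y$ we have $$\mathrm{gd}(X\times Y)\le \max\{\pi(X),\mathrm{gd}(Y)\}.$$
   Context: $X\times Y$ carries the product topology. $\pi(X)$ is the $\pi$-weight: the least cardinality of a $\pi$-basis of $X$, i.e. of a system of non-empty open sets such that every non-empty open subset of $X$ contains a member of it. For a space $T$, $\mathrm{gd}(T)$ is the least infinite cardinal $\kappa$ such that Player I has a winning strategy in the game $G_{T,\kappa^+}$ defined below. The game $G_{T,\theta}$ ($T$ a topological space, $\theta$ an infinite ordinal) is the following two-player game of perfect information. The game advances in stages indexed by ordinals. At each stage $\alpha$, Player I chooses a non-empty open set $U_\alpha\subset T$ and then Player II chooses a point $x_\alpha\in U_\alpha$. The game ends at the (first) stage $\beta$ with $\overline{\{x_\alpha:\alpha<\beta\}}=T$. Player I wins if the game ends at a stage $\beta<\theta$; otherwise Player II wins. At each stage both players know the stage and the whole history of the game, and strategies may depend on these. *)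

(* Defs.v *)
From HB Require Import structures.
From mathcomp Require Import all_boot.
From mathcomp Require Import all_classical wochoice.
From mathcomp Require Import topology_structure product_topology.

Set Implicit Arguments.
Unset Strict Implicit.
Unset Printing Implicit Defensive.

Local Open Scope classical_set_scope.
Local Open Scope card_scope.

(* Cardinals are represented by types, up to equipotence. *)

Definition is_least_card (P : Type -> Prop) (K : Type) : Prop :=
  P K /\ forall L : Type, P L -> [set: K] #<= [set: L].

(* The least cardinal satisfying [P]; it is determined up to equipotence as
   soon as [P] is invariant under equipotence and holds for some type.  The
   value [void] is a default for unsatisfiable [P]. *)
Definition least_card (P : Type -> Prop) : Type :=
  if pselect (exists K, is_least_card P K) is left ex then sval (cid ex)
  else void.

Definition card_max (K L : Type) : Type :=
  if [set: K] #<= [set: L] then L else K.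

Definition pi_basis (X : topologicalType) (B : set (set X)) : Prop :=
  (forall U, B U -> open U /\ U !=set0) /\
  (forall V : set X, open V -> V !=set0 -> exists2 U, B U & U `<=` V).

Definition pi_weight (X : topologicalType) : Type :=
  least_card (fun K => exists2 B : set (set X), pi_basis B & B #= [set: K]).

(* An ordinal theta is represented by a type W with a well-order le; the
   elements of W are the ordinals smaller than theta. *)

Definition below (W : Type) (le : rel W) (a : W) : set W :=
  [set b | le b a /\ b <> a].

(* (W, le) has order type K^+, the least ordinal of cardinality > K. *)
Definition succ_card_order (K W : Type) (le : rel W) : Prop :=
  [/\ well_order le,
      ~~ ([set: W] #<= [set: K]) &
      forall a : W, below le a #<= [set: K]].

Section Game.
Variables (T : topologicalType) (W : Type) (le : rel W).

(* The history at stage a: the moves (U_b, x_b) for b < a. *)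
Definition history (a : W) : Type := below le a -> set T * T.

Definition legal (a : W) (p : history a) : Prop :=
  forall b, open (p b).1 /\ (p b).1 (p b).2.

Definition ended (a : W) (p : history a) : Prop :=
  closure (range (fun b => (p b).2)) = [set: T].

Definition strategyI : Type := forall a : W, history a -> set T.

Definition valid_strategyI (s : strategyI) : Prop :=
  forall (a : W) (p : history a), legal p -> ~ ended p ->
    open (s a p) /\ s a p !=set0.

Definition truncate (h : W -> set T * T) (a : W) : history a :=
  fun b => h (val b).
Arguments truncate : clear implicits.

(* The rules only constrain h up to the end of the game: the values of h from
   that stage on are irrelevant padding.  If T is empty there is no h at all,
   in accordance with the fact that the game then ends at stage 0. *)
Definition play_against (s : strategyI) (h : W -> set T * T) : Prop :=
  forall a : W, ~ ended (truncate h a) ->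
    (h a).1 = s a (truncate h a) /\ (h a).1 (h a).2.

Definition winning_strategyI (s : strategyI) : Prop :=
  valid_strategyI s /\
  forall h, play_against s h -> exists b : W, ended (truncate h b).

Definition playerI_wins : Prop := exists s, winning_strategyI s.

End Game.

Definition gd (T : topologicalType) : Type :=
  least_card (fun K => infinite_set [set: K] /\
    exists (W : Type) (le : rel W),
      succ_card_order K le /\ playerI_wins T le).

(* Main.v *)
Require Import Defs.
From HB Require Import structures.
From mathcomp Require Import all_boot.
From mathcomp Require Import all_classical wochoice.
From mathcomp Require Import topology_structure product_topology.

(** Let K be the maximum of the pi-weight of X and gd(Y).  The point is to
    describe a winning strategy of Player I in the game of length K^+ on X * Y.
    Fix a pi-basis B of X with at most K members and a strategy s winning the
    game of length K^+ on Y ([playerI_wins_le]: a strategy for gd(Y)^+ is one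
    for K^+).  For each U in B, Player I conducts a separate copy of the game
    on Y: a move of that copy in which s proposes V is made in the product as
    U * V, and of the answer (x, y) only y is reported to the copy.  At each
    stage Player I picks any copy whose points are not yet dense in Y and makes
    the next move of it.  As V is non-empty, the first projection of the move
    is U, which tells to which copy the move belongs.

    If no copy is left to be picked, then every U * V contains a point chosen
    so far, hence these points are dense in X * Y ([product_dense]).  So assume
    that the game lasts through all K^+ stages.  Then K^+ is the union of
    at most K sets, one for each copy, and since K * K = K one copy receives
    more than K stages ([card_le_fibers], [card_square_le]).  As a subset of
    K^+ of size more than K, this set of stages has order type K^+, so that the
    copy is a complete play of length K^+ against s, in which the points never
    became dense; s being winning, this is absurd ([product_wins]).

    The stages of a copy form a subset S of K^+ which has to be renumbered by
    an initial segment of K^+.  This is done by the collapse of S: the map c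
    such that c(a) is the order type of the part of S below a, characterized
    by c(S below a) = {u : u < c(a)} ([is_collapse]).  Collapses of one
    well-ordered set into another also carry the cardinal arithmetic that is
    needed: comparability of cardinals, existence of least cardinals
    ([least_cardP]), and K * K = K, the latter by collapsing Goedel's
    well-order of the square. *)

Set Implicit Arguments.
Unset Strict Implicit.
Unset Printing Implicit Defensive.

Local Open Scope classical_set_scope.
Local Open Scope card_scope.


(** * Well-orders *)

Lemma well_order_min (W : Type) (le : rel W) (P : set W) :
  well_order le -> P !=set0 ->
  exists2 m, P m & forall x, P x -> le m x.
Proof.
move=> wo [x Px].
have [|m [[/asboolP Pm lem] _]] := wo (fun x => `[< P x >]).
  by exists x; apply/asboolP.
by exists m => // y Py; apply: lem; apply/asboolP.
Qed.

Lemma well_orderxx (W : Type) (le : rel W) : well_order le -> reflexive le.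
Proof.
move=> wo x; have [|m -> lem] := well_order_min (P := [set x]) wo.
  by exists x.
exact: lem.
Qed.

Lemma well_order_total (W : Type) (le : rel W) : well_order le -> total le.
Proof.
move=> wo x y; have [|m Pm lem] := well_order_min (P := [set x; y]) wo.
  by exists x; left.
by case: Pm => <-; apply/orP; [left|right]; apply: lem; [right|left].
Qed.

Lemma well_order_anti (W : Type) (le : rel W) x y :
  well_order le -> le x y -> le y x -> x = y.
Proof.
move=> wo xy yx; have [|m [_ um]] := wo (fun z => `[< z = x \/ z = y >]).
  by exists x; apply/asboolP; left.
have lexx := well_orderxx wo.
rewrite -(um x) ?(um y) //; split; do ?[by apply/asboolP; left
  | by apply/asboolP; right] => z /asboolP[]->//.
Qed.

Lemma well_order_trans (W : Type) (le : rel W) : well_order le -> transitive le.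
Proof.
move=> wo y x z xy yz.
have [|m Pm lem] := well_order_min (P := [set x; y; z]) wo.
  by exists x; left; left.
have [lex ley lez] : [/\ le m x, le m y & le m z].
  by split; apply: lem; [left; left|left; right|right].
case: Pm lex ley lez => [[]|] -> // lex ley lez.
- by rewrite (well_order_anti wo xy lex).
- by rewrite -(well_order_anti wo yz ley).
Qed.

Lemma below_trans (W : Type) (le : rel W) x y z :
  well_order le -> below le y x -> below le z y -> below le z x.
Proof.
move=> wo [xy nxy] [yz nyz]; split; first exact: well_order_trans xy yz.
by move=> xz; apply: nxy; apply: (well_order_anti wo xy); rewrite xz.
Qed.

Lemma below_le_trans (W : Type) (le : rel W) x y z :
  well_order le -> below le y x -> le y z -> below le z x.
Proof.
move=> wo [xy nxy] yz; split; first exact: well_order_trans xy yz.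
by move=> xz; apply: nxy; apply: (well_order_anti wo xy); rewrite xz.
Qed.

Lemma below_asym (W : Type) (le : rel W) x y :
  well_order le -> below le y x -> le y x -> False.
Proof. by move=> wo [xy nxy] yx; exact/nxy/(well_order_anti wo). Qed.

Lemma below_trichotomy (W : Type) (le : rel W) x y :
  well_order le -> [\/ below le y x, x = y | below le x y].
Proof.
move=> wo; have [->|xy] := pselect (x = y); first exact: Or32.
have [lexy|leyx] := orP (well_order_total wo x y).
- by apply: Or31; split.
- by apply: Or33; split => // /esym.
Qed.

Lemma below_inj (W : Type) (le : rel W) x y :
  well_order le -> below le x = below le y -> x = y.
Proof.
move=> wo xy; have [|//|] := below_trichotomy x y wo.
- by rewrite -xy => -[].
- by rewrite xy => -[].
Qed.

Lemma well_order_wf (W : Type) (le : rel W) :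
  well_order le -> well_founded (fun b a => below le a b).
Proof.
move=> wo a; apply: contrapT => nacc.
have [|m nm lem] :=
  well_order_min (P := [set x | ~ Acc (fun b a => below le a b) x]) wo.
  by exists a.
apply: nm; constructor => b bm; apply: contrapT => /lem.
exact: (below_asym wo bm).
Qed.

Lemma well_order_ind (W : Type) (le : rel W) (P : W -> Prop) :
  well_order le -> (forall a, (forall b, below le a b -> P b) -> P a) ->
  forall a, P a.
Proof. by move=> wo IH; apply: (well_founded_ind (well_order_wf wo)). Qed.

Lemma exists_well_order (T : Type) : exists le : rel T, well_order le.
Proof. by have [le] := well_ordering_principle {classic T}; exists le. Qed.

Lemma well_order_relpre (V W : Type) (f : V -> W) (le : rel W) :
  injective f -> well_order le -> well_order (relpre f le).
Proof.
move=> finj wo; apply: antisymmetric_well_order.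
  by move=> x y /andP[xy yx]; exact/finj/(well_order_anti wo).
move=> A [x Ax].
have [|_ [y Ay <-] lem] := well_order_min (P := f @` [set` A]) wo.
  by exists (f x), x.
by exists y; split => // z Az; apply: lem; exists z.
Qed.

Definition lex_rel (V W : Type) (leV : rel V) (leW : rel W) : rel (V * W) :=
  fun p q => `[< below leV q.1 p.1 \/ (p.1 = q.1 /\ leW p.2 q.2) >].

Lemma well_order_lex (V W : Type) (leV : rel V) (leW : rel W) :
  well_order leV -> well_order leW -> well_order (lex_rel leV leW).
Proof.
move=> woV woW; apply: antisymmetric_well_order.
  move=> [a b] [c d] /andP[/asboolP/= ab /asboolP/= cd].
  case: ab cd => [ac|[-> bd]] [ca|[e db]].
  - by case: (below_asym woV ac); case: ca.
  - by case: ac => _; rewrite e.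
  - by case: ca.
  - by rewrite (well_order_anti woW bd db).
move=> A [[x y] Axy].
have [|a [b Aab] lea] := well_order_min (P := [set a | exists b, (a, b) \in A]) woV.
  by exists x, y.
have [|d Aad led] := well_order_min (P := [set b | (a, b) \in A]) woW.
  by exists b.
exists (a, d); split => // -[u v] Auv; apply/asboolP => /=.
have [e|au] := pselect (a = u).
  by right; split => //; apply: led; rewrite /= e.
by left; split => //; apply: lea; exists v.
Qed.

(** * Collapsing a subset of a well-order *)

(** The values of [c] outside [S] are constrained too: [c a] is the order type
    of the part of [S] below [a] for each [a], so that [c] also tells at which
    position a stage [a] that is about to enter [S] would be numbered. *)
Definition is_collapse (V W : Type) (leV : rel V) (leW : rel W)
    (S : set V) (c : V -> W) :=
  forall a, c @` (S `&` below leV a) = below leW (c a).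

(** By well-founded recursion, [c a] is the least element of [W] that is not a
    value of [c] on the part of [S] below [a].  The cardinality assumption says
    that these values never exhaust [W]. *)
Lemma exists_collapse (V W : Type) (leV : rel V) (leW : rel W) (S : set V) :
  well_order leV -> well_order leW ->
  (forall a, ~ ([set: W] #<= S `&` below leV a)) ->
  exists c, is_collapse leV leW S c.
Proof.
move=> woV woW big.
have [v0|noV] := pselect (inhabited V); last first.
  have c : V -> W by move=> v; case: noV; constructor.
  by exists c => a; case: noV; constructor.
have {v0} w0 : inhabited W.
  apply: contrapT => noW; case: v0 => v0; apply: (big v0).
  suff -> : [set: W] = set0 by exact: card_ge0.
  by rewrite -subset0 => w; case: noW; constructor.
case: w0 => w0.
pose least (P : set W) : W :=
  if pselect (exists2 m, P m & forall x, P x -> leW m x) is left e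
  then s2val (cid2 e) else w0.
pose step a (rec : forall b, below leV a b -> W) : W :=
  least [set w | ~ exists b, exists2 H : below leV a b, S b & rec b H = w].
pose c := Fix (well_order_wf woV) (fun=> W) step.
have cE a : c a = least (~` (c @` (S `&` below leV a))).
  rewrite /c Fix_eq; last first.
    move=> x f g fg; rewrite /step; congr least; rewrite predeqE => w /=.
    by split=> nw [b [H Sb e]]; apply: nw; exists b; exists H; rewrite ?fg// -fg.
  rewrite {1}/step; congr least; rewrite predeqE => w /=.
  split=> nw.
  - by move=> [b [Sb ba] e]; apply: nw; exists b; exists ba.
  - by move=> [b [ba Sb e]]; apply: nw; exists b.
have cP a : (~ (c @` (S `&` below leV a)) (c a)) /\
    forall w, ~ (c @` (S `&` below leV a)) w -> leW (c a) w.
  rewrite cE /least; case: pselect => [e|]; first by case: (cid2 e).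
  case; apply: well_order_min => //; apply: contrapT => noncov.
  apply: (big a); apply: (@card_le_trans _ _ _ (c @` (S `&` below leV a))).
    apply: subset_card_le => w _; apply: contrapT => nw.
    by apply: noncov; exists w.
  exact: card_image_le.
exists c => a; rewrite predeqE => w; split.
- move=> [b [Sb ba] <-]; split; last first.
    by move=> e; apply: (cP a).1; rewrite -e; exists b.
  apply: (cP b).2 => -[d [Sd db] e]; apply: (cP a).1.
  by exists d => //; split => //; exact: (below_trans _ db).
- move=> wa; apply: contrapT => nw.
  exact: (below_asym woW wa ((cP a).2 _ nw)).
Qed.

Lemma collapse_inj (V W : Type) (leV : rel V) (leW : rel W) (S : set V) c :
  well_order leV -> is_collapse leV leW S c ->
  {in S &, injective c}.
Proof.
move=> woV cP a b /set_mem Sa /set_mem Sb cab.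
have ncb x y : S x -> below leV y x -> c x <> c y.
  move=> Sx xy cxy; have : below leW (c y) (c x) by rewrite -cP; exists x.
  by case.
by case: (below_trichotomy a b woV) => // /ncb-/(_ _)/[!cab]; [case|move/(_ Sb)].
Qed.

(** The number given to stage [a] is determined by the part of [S] before [a];
    a strategy that uses it therefore depends on the history only. *)
Lemma collapse_local (V W : Type) (leV : rel V) (leW : rel W) (S S' : set V) c c' a :
  well_order leV -> well_order leW ->
  is_collapse leV leW S c -> is_collapse leV leW S' c' ->
  S `&` below leV a = S' `&` below leV a -> c a = c' a.
Proof.
move=> woV woW cP cP'; move: a; apply: (well_order_ind woV) => a IH SS'.
apply: (below_inj woW); rewrite -cP -cP' -SS'.
apply: eq_imagel => b [Sb ba]; apply: IH => //.
rewrite predeqE => d; split=> -[Sd db]; split => //.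
- have : (S `&` below leV a) d by split => //; exact: (below_trans _ db).
  by rewrite SS' => -[].
- have : (S' `&` below leV a) d by split => //; exact: (below_trans _ db).
  by rewrite -SS' => -[].
Qed.

(** The values of a collapse form an initial segment, which is everything or
    the segment below the least element that is missed. *)
Lemma collapse_image (V W : Type) (leV : rel V) (leW : rel W) (S : set V) c :
  well_order leW -> is_collapse leV leW S c ->
  c @` S = [set: W] \/ exists u, c @` S = below leW u.
Proof.
move=> woW cP; have [allW|nall] := pselect (forall w, (c @` S) w).
  by left; rewrite predeqE => w; split.
right; have [|u nu leu] := well_order_min (P := ~` (c @` S)) woW.
  by apply: contrapT => ne; apply: nall => w; apply: contrapT => nw;
    apply: ne; exists w.
exists u; rewrite predeqE => w; split => [[b Sb <-]|wu].
  have [//|e|ub] := below_trichotomy (c b) u woW.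
    by case: nu; rewrite -e; exists b.
  by case: nu; move: ub; rewrite -cP => -[d [Sd _] <-]; exists d.
by apply: contrapT => /leu; exact: (below_asym woW wu).
Qed.


(** * Cardinals *)

Lemma inj_card_leS (A B : Type) (f : A -> B) (S : set A) (D : set B) :
  {in S &, injective f} -> f @` S `<=` D -> S #<= D.
Proof.
move=> /inj_card_eq/card_eqPle[_ Sf] SD.
exact: card_le_trans Sf (subset_card_le SD).
Qed.

Lemma inj_card_leT (A B : Type) (f : A -> B) (S : set A) :
  {in S &, injective f} -> S #<= [set: B].
Proof. by move=> finj; apply: inj_card_leS finj _. Qed.

Lemma card_le_inj (A B : Type) (S : set A) (D : set B) (b0 : B) :
  S #<= D -> exists2 f : A -> B, {in S &, injective f} & forall x, S x -> D (f x).
Proof.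
move=> /card_leP[g].
exists (fun a => if pselect (S a) is left Sa then val (g (SigSub (mem_set Sa))) else b0).
  move=> a b /set_mem aS /set_mem bS; case: pselect => // Sa; case: pselect => // Sb.
  move=> /val_inj e.
  have := @inj _ _ _ g (SigSub (mem_set Sa)) (SigSub (mem_set Sb)).
  by rewrite !in_setT => /(_ isT isT e) -[->].
by move=> x Sx; case: pselect => // Sx'; case: (g _) => y /= /set_mem.
Qed.

Lemma Cantor (K : Type) : ~ ([set: set K] #<= [set: K]).
Proof.
move=> le; have [k0|nk] := pselect (inhabited K); last first.
  suff : [set: K] = set0.
    by move=> K0; move: le; rewrite K0 card_le0 => /eqP/seteqP[/(_ set0 I)].
  by rewrite -subset0 => k; case: nk.
case: k0 => /card_le_inj/(_ le)[f /in2TT finj _].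
(* Cantor's diagonal set, read through the injection [f]. *)
pose D := [set k | exists2 A : set K, f A = k & ~ A k].
have nD : ~ D (f D) by move=> /[dup] DfD [A /finj ->]; exact.
by apply: (nD); exists D.
Qed.

(** Collapse a well-order of [A] into a well-order of [B]; the recursion can
    only be blocked by exhausting [B], which gives the other inequality. *)
Lemma card_le_total (A B : Type) :
  [set: A] #<= [set: B] \/ [set: B] #<= [set: A].
Proof.
have [[leA woA] [leB woB]] := (exists_well_order A, exists_well_order B).
have [[a Ba]|small] := pselect (exists a, [set: B] #<= below leA a).
  by right; apply: card_le_trans Ba (card_leT _).
left; have [|c cP] := exists_collapse (S := setT) woA woB.
  by move=> a; rewrite setTI => Ba; apply: small; exists a.
exact: inj_card_leT (collapse_inj woA cP).
Qed.

Lemma card_le_below_relpre (V W : Type) (f : V -> W) (le : rel W) a :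
  injective f -> below (relpre f le) a #<= below le (f a).
Proof.
move=> finj; apply: (@inj_card_leS _ _ f) => [? ? _ _|_ [b [/= ba nba] <-]].
  exact: finj.
by split => // /finj.
Qed.

(** The elements of a well-ordered power set of [K] with at most [K]
    predecessors form an initial segment.  Were it of size at most [K], the
    least element outside it would belong to it, and there is one by Cantor's
    theorem. *)
Lemma succ_card_order_exists (K : Type) :
  exists (W : Type) (le : rel W), succ_card_order K le.
Proof.
have [le wo] := exists_well_order (set K).
pose W := [set b | below le b #<= [set: K]].
exists W, (relpre val le); split.
- exact: well_order_relpre val_inj wo.
- rewrite (card_le_eql (card_setT _)); apply/negP => WK.
  have [allW|nall] := pselect (forall b, W b).
    have : [set: set K] #<= [set: K].
      by apply: card_le_trans WK; apply: subset_card_le => b _; exact: allW.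
    exact: Cantor.
  have [|a nWa lea] := well_order_min (P := ~` W) wo.
    by apply: contrapT => ne; apply: nall => b; apply: contrapT => nb;
      apply: ne; exists b.
  apply: nWa; apply: card_le_trans WK; apply: subset_card_le => b ba.
  by apply: contrapT => /lea; exact: (below_asym wo ba).
- move=> [a aW]; apply: (@card_le_trans _ _ _ (below le a)); last exact: set_mem.
  exact: card_le_below_relpre val_inj.
Qed.

(** In any well-order take the least [a] below which there are as many elements
    as in [K], if there is one, and pull the order back along an injection of
    [K] into the segment below [a]. *)
Lemma initial_well_order (K : Type) :
  exists le : rel K, well_order le /\ forall a, ~ ([set: K] #<= below le a).
Proof.
have [le wo] := exists_well_order K.
have [e|ini] := pselect ([set a | [set: K] #<= below le a] !=set0); last first.
  by exists le; split => // a Ka; apply: ini; exists a.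
have [a Ka lea] := well_order_min wo e.
have [f finj fa] : exists2 f : K -> K, injective f & forall k, below le a (f k).
  by have [f /in2TT finj fa] := card_le_inj a Ka; exists f => // k; exact: fa.
exists (relpre f le); split; first exact: well_order_relpre.
move=> k Kk; apply: (below_asym wo (fa k)); apply: lea.
exact: card_le_trans Kk (card_le_below_relpre _ _ finj).
Qed.

(** If [P K] holds, each type of size at most [K] is equipotent to a segment of
    the well-order of type K^+, by collapsing.  The least element of that order
    below which there are as many elements as in some type satisfying [P] gives
    the least cardinal. *)
Lemma least_cardP (P : Type -> Prop) :
  (forall K L, [set: K] #= [set: L] -> P K -> P L) ->
  (exists K, P K) -> is_least_card P (least_card P).
Proof.
move=> Peq [K PK]; rewrite /least_card; case: pselect => [e|ne].
  by case: (cid e).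
exfalso; apply: ne; have [W [le [wo WK smallW]]] := succ_card_order_exists K.
have embed L : [set: L] #<= [set: K] -> exists w, [set: L] #= below le w.
  move=> LK; have [leL woL] := exists_well_order L.
  have [|c cP] := exists_collapse (S := setT) woL wo.
    move=> a Wa; move/negP : WK; apply; apply: card_le_trans LK.
    exact: card_le_trans Wa (card_leT _).
  have cT : c @` setT #= [set: L] by apply: inj_card_eq; exact: collapse_inj cP.
  have [e|[w e]] := collapse_image wo cP.
    by exfalso; move/negP : WK; apply; rewrite -e (card_le_eql cT).
  by exists w; rewrite -e card_eq_sym.
have [|w [M PM wM] lew] := well_order_min (P :=
    [set w | exists2 M, P M & [set: M] #= below le w]) wo.
  by have [w Kw] := embed K (card_lexx _); exists w, K.
exists M; split => // L PL.
have PKM (N : Type) : P N -> [set: N] #<= [set: K] -> [set: M] #<= [set: N].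
  move=> PN /embed[v Nv]; rewrite (card_le_eql wM) (card_le_eqr Nv).
  apply: subset_card_le => x xw; apply: below_le_trans xw (lew _ _) => //.
  by exists N.
have [LK|KL] := card_le_total L K; first exact: PKM.
exact: card_le_trans (PKM K PK (card_lexx _)) KL.
Qed.

(** Hilbert's hotel: shift a sequence of distinct points that starts at [z]. *)
Lemma infinite_card_le_setC1 (M : Type) (z : M) :
  infinite_set [set: M] -> [set: M] #<= ~` [set z].
Proof.
move=> infM; have : infinite_set (~` [set z]).
  by rewrite -setTD; apply: infinite_setD => //; exact: finite_set1.
move=> /infiniteP/(card_le_inj z)[i /in2TT iinj iz].
pose j n := if n is n'.+1 then i n' else z.
have jinj : injective j.
  move=> [|m] [|n] //= e; first by case: (iz n I).
    by case: (iz m I).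
  by rewrite (iinj _ _ e).
pose g x := if pselect (exists n, j n = x) is left e then j (sval (cid e)).+1 else x.
have gj n : g (j n) = j n.+1.
  rewrite /g; case: pselect => [e|[]]; last by exists n.
  by case: (cid e) => m /= /jinj ->.
have gN x : (forall n, j n <> x) -> g x = x.
  by rewrite /g; case: pselect => // -[n nx] /(_ n).
have dec x : (exists n, x = j n) \/ (forall n, j n <> x).
  have [[n nx]|h] := pselect (exists n, x = j n); [left; by exists n|right].
  by move=> n nx; apply: h; exists n.
have ginj : injective g.
  move=> x y; case: (dec x) => [[m ->]|nx]; case: (dec y) => [[n ->]|ny].
  - by rewrite !gj => /jinj[->].
  - by rewrite gj gN // => /ny.
  - by rewrite gj gN // => /esym/nx.
  - by rewrite !gN.
apply: (@inj_card_leS _ _ g) => [? ? _ _|_ [x _ <-] /= gz]; first exact: ginj.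
have [[n xn]|nx] := dec x; last by rewrite gN // in gz; exact: (nx 0).
by move: gz; rewrite xn gj => /(jinj n.+1 0).
Qed.

(** For a counterexample [M] of least cardinality, well-order [M] so that proper
    segments are smaller than [M], and well-order the square by the larger
    coordinate first.  Below a given pair, all coordinates lie in a closed
    segment of [M]; this segment is smaller than [M], and by minimality so is
    its square.  Hence the square of [M] collapses into [M]. *)
Lemma card_square_le (K : Type) :
  infinite_set [set: K] -> [set: K * K] #<= [set: K].
Proof.
move=> infK; apply: contrapT => bigK.
pose P L := infinite_set [set: L] /\ ~ ([set: L * L] #<= [set: L]).
have Pinv A B : [set: A] #= [set: B] -> P A -> P B.
  move=> AB [infA bigA]; split; first by rewrite -(eq_finite_set AB).
  move=> BB; apply: bigA; rewrite (card_le_eqr AB); apply: card_le_trans BB.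
  have [b0|nb] := pselect (inhabited B); last first.
    case: infA; rewrite (eq_finite_set AB).
    suff -> : [set: B] = set0 by exact: finite_set0.
    by rewrite -subset0 => b; case: nb.
  case: b0 => b0; have /card_eqPle[/(card_le_inj b0)[f /in2TT finj _] _] := AB.
  apply: (@inj_card_leT _ _ (fun p => (f p.1, f p.2))).
  by move=> [a b] [c d] _ _ /= [/finj -> /finj ->].
have [] := least_cardP Pinv; first by exists K.
move: (least_card P) => M [infM bigM] minM; apply: bigM.
have [le [wo ini]] := initial_well_order M.
pose sup p := if le p.1 p.2 then p.2 else p.1 : M.
have supP p : le p.1 (sup p) /\ le p.2 (sup p).
  rewrite /sup; case: ifPn => i; split; rewrite ?(well_orderxx wo)//.
  by have /orP[|//] := well_order_total wo p.1 p.2; rewrite (negbTE i).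
pose G := relpre (fun p : M * M => (sup p, p)) (lex_rel le (lex_rel le le)).
have woG : well_order G.
  apply: well_order_relpre; first by move=> p q [].
  by do ?apply: well_order_lex.
have [|c cP] := exists_collapse (S := setT) woG wo; last first.
  exact: inj_card_leT (collapse_inj woG cP).
move=> p; rewrite setTI => Mp; pose D := [set x | le x (sup p)].
have pD : below G p `<=` D `*` D.
  move=> q [/asboolP/= qp _]; have [q1 q2] := supP q.
  have qsup : le (sup q) (sup p).
    by case: qp => [[]//|[-> _]]; exact: well_orderxx.
  by split; [exact: (well_order_trans wo q1 qsup)|exact: (well_order_trans wo q2 qsup)].
have {Mp pD} MD2 := card_le_trans Mp (subset_card_le pD).
have [finD|infD] := pselect (finite_set D).
  by apply: infM; apply: card_le_finite MD2 _; exact: finite_setX.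
(* Otherwise the size of [D] would be less than that of [M], so by minimality
   [D `*` D] would have the size of [D], although it receives [M]. *)
have MD : [set: M] #<= D.
  rewrite -(card_le_eqr (card_setT D)).
  have [D2|D2] := pselect ([set: D * D] #<= [set: D]).
    apply: card_le_trans D2; apply: card_le_trans MD2 _.
    apply: (@card_le_trans _ _ _ ((fun q : D * D => (val q.1, val q.2)) @` setT)).
      apply: subset_card_le => -[x y] [/= Dx Dy].
      by exists (SigSub (mem_set Dx), SigSub (mem_set Dy)).
    exact: card_image_le.
  by apply: minM; split => //; rewrite (eq_finite_set (card_setT D)).
have [f /in2TT finj fD] := card_le_inj p.1 MD.
(* [D] is the segment below [sup p] plus the point [sup p]; if the injection
   [f] takes that point at [z], drop [z] from its domain. *)
apply: (ini (sup p)); have [[z fz]|nz] := pselect (exists z, f z = sup p).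
  apply: card_le_trans (infinite_card_le_setC1 z infM) _.
  apply: (@inj_card_leS _ _ f) => [? ? _ _|_ [x xz <-]]; first exact: finj.
  by split; [exact: fD|rewrite -fz => /finj].
apply: (@inj_card_leS _ _ f) => [? ? _ _|_ [x _ <-]]; first exact: finj.
by split; [exact: fD|move=> fx; apply: nz; exists x].
Qed.


(** * Strategies on total histories *)

(** This is the condition [ended] for a history given as the restriction of a
    function on all stages; such functions spare the dependent types. *)
Definition dense_before (T : topologicalType) (W : Type) (le : rel W)
    (h : W -> set T * T) (a : W) : Prop :=
  closure ((fun b => (h b).2) @` below le a) = [set: T].

Definition legal_move (T : topologicalType) (m : set T * T) : Prop :=
  open m.1 /\ m.1 m.2.

Lemma ended_truncate (T : topologicalType) (W : Type) (le : rel W)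
    (h : W -> set T * T) (a : W) :
  ended (truncate (le:=le) (a:=a) h) = dense_before le h a.
Proof.
rewrite /ended /dense_before; congr (closure _ = _); rewrite predeqE => t.
split=> [[[b /= bP] _ <-]|[b ba <-]]; first by exists b => //; exact: set_mem.
by exists (SigSub (mem_set ba)).
Qed.

Lemma dense_beforeP (T : topologicalType) (W : Type) (le : rel W)
    (h : W -> set T * T) (a : W) :
  dense_before le h a <->
  forall O, open O -> O !=set0 -> exists2 b, below le a b & O (h b).2.
Proof.
rewrite /dense_before; split=> [clE O oO [t Ot]|dn].
  have : closure ((fun b => (h b).2) @` below le a) t by rewrite clE.
  move=> /(_ O (open_nbhs_nbhs (conj oO Ot)))[_ [[b ba <-] Ob]].
  by exists b.
rewrite predeqE => t; split => // _ B.
rewrite nbhsE => -[O [oO Ot] OB].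
have [|b ba Ob] := dn O oO; first by exists t.
by exists (h b).2; split; [exists b|exact: OB].
Qed.

Definition extend (T : topologicalType) (W : Type) (le : rel W) (t : T)
    (a : W) (p : history T le a) : W -> set T * T :=
  fun b => if pselect (below le a b) is left ba then p (SigSub (mem_set ba))
           else (setT, t).

Lemma truncate_extend (T : topologicalType) (W : Type) (le : rel W) (t : T)
    (a : W) (p : history T le a) : truncate (le:=le) (a:=a) (extend t p) = p.
Proof.
apply/funext => b; rewrite /truncate /extend.
case: pselect => [ba|]; first by congr p; exact: val_inj.
by case; exact: (set_mem (valP b)).
Qed.

Lemma extend_truncate (T : topologicalType) (W : Type) (le : rel W) (t : T)
    (a : W) (h : W -> set T * T) b :
  below le a b -> extend t (truncate (le:=le) (a:=a) h) b = h b.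
Proof. by rewrite /extend; case: pselect. Qed.

(** A strategy may be given as a function of a play through all stages of
    which it uses only the moves before the current stage.  It suffices to beat
    the plays in which all moves are legal and the game never ends: against
    a valid strategy, legality of the moves follows by induction on the
    stage. *)
Lemma playerI_wins_total (T : topologicalType) (W : Type) (le : rel W) (t : T)
    (sigma : W -> (W -> set T * T) -> set T) :
  well_order le ->
  (forall a h h', (forall b, below le a b -> h b = h' b) ->
     sigma a h = sigma a h') ->
  (forall a h, (forall b, legal_move (h b)) -> ~ dense_before le h a ->
     open (sigma a h) /\ sigma a h !=set0) ->
  (forall h, (forall a, legal_move (h a)) ->
     (forall a, ~ dense_before le h a) -> ~ forall a, (h a).1 = sigma a h) ->
  playerI_wins T le.
Proof.
move=> wo loc valid win; exists (fun a p => sigma a (extend t p)).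
have validI : valid_strategyI (le := le) (fun a p => sigma a (extend t p) : set T).
  move=> a p lp; rewrite -{1}(truncate_extend t p) ended_truncate => np.
  apply: valid np => b; rewrite /extend; case: pselect => [ba|_] //.
  by split => //; exact: openT.
split=> // h hP; apply: contrapT => nend.
have {}nend a : ~ dense_before le h a.
  by rewrite -ended_truncate => e; apply: nend; exists a.
have {}hP a : (h a).1 = sigma a (extend t (truncate (le:=le) (a:=a) h)) /\ (h a).1 (h a).2.
  by apply: hP; rewrite ended_truncate.
have lh : forall a, legal_move (h a).
  apply: (well_order_ind wo) => a IH; split; last exact: (hP a).2.
  rewrite (hP a).1; have [|//|//] := validI a (truncate (le:=le) (a:=a) h).
    by move=> [b bP]; apply: IH; exact: set_mem.
  by rewrite ended_truncate.
apply: (win h) => // a; rewrite (hP a).1; apply: loc => b ba.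
exact: extend_truncate.
Qed.

(** On an empty space the empty set of points is dense, so that the game is over
    at stage 0. *)
Lemma playerI_wins_empty (T : topologicalType) (W : Type) (le : rel W) (a : W) :
  ~ inhabited T -> playerI_wins T le.
Proof.
move=> noT; have all_ended b (p : history T le b) : ended p.
  by rewrite /ended predeqE => t; case: noT.
exists (fun _ _ => setT); split=> [b p _ []//|h _].
by exists a.
Qed.

Lemma succ_card_order_inh (K W : Type) (le : rel W) :
  succ_card_order K le -> inhabited W.
Proof.
move=> [_ /negP WK _]; apply: contrapT => noW; apply: WK.
suff -> : [set: W] = set0 by exact: card_ge0.
by rewrite -subset0 => w; case: noW.
Qed.

(** * The cardinal gd *)

(** [gd T] is the least cardinal with this property, by definition. *)
Definition gd_bound (T : topologicalType) (K : Type) : Prop :=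
  infinite_set [set: K] /\
  exists (W : Type) (le : rel W), succ_card_order K le /\ playerI_wins T le.

(** Player I plays the complement of the closure of the points chosen so far.
    Then all points are distinct, so the game cannot last longer than the
    successor cardinal of the size of the space. *)
Lemma gd_bound_exists (T : topologicalType) : exists K, gd_bound T K.
Proof.
exists (T + nat)%type; split.
  apply/infiniteP; apply: (@inj_card_leT _ _ inr) => m n _ _; exact: inr_inj.
have [W [le sW]] := succ_card_order_exists (T + nat); exists W, le; split => //.
have [w0] := succ_card_order_inh sW; case: (sW) => wo /negP WK _.
have [[t]|] := pselect (inhabited T); last exact: playerI_wins_empty.
apply: (@playerI_wins_total _ _ _ t (fun a h =>
  ~` closure ((fun b => (h b).2) @` below le a))) => //.
- by move=> a h h' hh'; congr (~` closure _); apply: eq_imagel => b /hh' ->.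
- move=> a h _ nd; split; first by apply: closed_openC; exact: closed_closure.
  apply: contrapT => e; apply: nd; rewrite /dense_before predeqE => x; split => // _.
  by apply: contrapT => nx; apply: e; exists x.
- move=> h lh nd hP; apply: WK; apply: (@inj_card_leT _ _ (fun a => inl (h a).2)).
  have new a b : below le a b -> (h b).2 <> (h a).2.
    move=> ba e; have [_] := lh a; rewrite hP; apply; apply: subset_closure.
    by exists b.
  move=> a b _ _ [e]; have [ba|//|ab] := below_trichotomy a b wo.
    by case: (new b a).
  by case: (new a b).
Qed.

Lemma gd_bound_eq (T : topologicalType) (K L : Type) :
  [set: K] #= [set: L] -> gd_bound T K -> gd_bound T L.
Proof.
move=> KL [infK [W [le [[wo WK small] wins]]]]; split.
  by rewrite -(eq_finite_set KL).
exists W, le; split => //; split => //; first by rewrite -(card_le_eqr KL).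
by move=> a; rewrite -(card_le_eqr KL).
Qed.

Lemma gdP (T : topologicalType) : is_least_card (gd_bound T) (gd T).
Proof. exact: least_cardP (@gd_bound_eq T) (gd_bound_exists T). Qed.

(** K^+ is an initial segment of L^+; the collapse [e] embeds it as such, and
    Player I follows the given strategy there.  It makes the game end
    within that segment. *)
Lemma playerI_wins_le (T : topologicalType) (K L V W : Type)
    (leV : rel V) (leW : rel W) :
  [set: K] #<= [set: L] -> succ_card_order K leV -> succ_card_order L leW ->
  playerI_wins T leV -> playerI_wins T leW.
Proof.
move=> KL [woV _ smallV] sW.
have [w0] := succ_card_order_inh sW; case: (sW) => woW /negP WL _.
have [[t]|] := pselect (inhabited T); last by move=> ? _; exact: playerI_wins_empty.
move=> [s [svalid swin]].
have [|e eP] := exists_collapse (S := setT) woV woW.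
  move=> a; rewrite setTI => Wa; apply: WL.
  exact: card_le_trans (card_le_trans Wa (smallV a)) KL.
have einj : injective e by move=> x y; apply: (collapse_inj woV eP); rewrite in_setT.
have dE h v : dense_before leV (h \o e) v = dense_before leW h (e v).
  by rewrite /dense_before -eP setTI image_comp.
apply: (@playerI_wins_total _ _ _ t (fun w h =>
  if pselect (exists v, e v = w) is left x
  then s (sval (cid x)) (truncate (le:=leV) (a:=sval (cid x)) (h \o e)) else setT)) => //.
- move=> w h h' hh'; case: pselect => // x; case: (cid x) => v /= vw.
  congr (s v _); apply/funext => -[b bP]; rewrite /truncate /=; apply: hh'.
  by rewrite -vw -eP; exists b => //; split => //; exact: set_mem.
- move=> w h lh; case: pselect => [x|_ _]; last by split; [exact: openT|exists t].
  case: (cid x) => v /= <- nd; apply: svalid.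
    by move=> b; exact: lh.
  by rewrite ended_truncate dE.
- move=> h lh nd hP; have [|v] := swin (h \o e).
    move=> v _; split; last by case: (lh (e v)).
    rewrite /= hP; case: pselect => [x|[]]; last by exists v.
    by case: (cid x) => v' /= /einj ->.
  by rewrite ended_truncate dE; exact: nd.
Qed.


(** * The game on a product *)

(** The stages spent on the copy of the game attached to [U]: when Player I
    plays [U `*` V] with [V] non-empty, the first projection is [U]. *)
Definition stages (X Y : topologicalType) (W : Type)
    (h : W -> set (X * Y) * (X * Y)) (U : set X) : set W :=
  [set a | fst @` (h a).1 = U].

Definition snd_move (X Y : topologicalType) (m : set (X * Y) * (X * Y)) :
    set Y * Y :=
  (snd @` m.1, m.2.2).

(** The copy played at the stages in [S], renumbered by the collapse [c].  The
    default move at the numbers that are not used is legal, so that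
    a legal play projects to a legal play of the copy. *)
Definition subplay (X Y : topologicalType) (W : Type) (y : Y) (S : set W)
    (c : W -> W) (h : W -> set (X * Y) * (X * Y)) (u : W) : set Y * Y :=
  if pselect (exists2 b, S b & c b = u) is left e
  then snd_move (h (s2val (cid2 e))) else (setT, y).

Lemma subplay_collapse (X Y : topologicalType) (W : Type) (y : Y) (S : set W)
    (c : W -> W) (h : W -> set (X * Y) * (X * Y)) b :
  {in S &, injective c} -> S b -> subplay y S c h (c b) = snd_move (h b).
Proof.
move=> cinj Sb; rewrite /subplay; case: pselect => [e|[]]; last by exists b.
case: (cid2 e) => d /= Sd cdb; congr (snd_move (h _)).
by apply: cinj cdb; exact/mem_set.
Qed.

Lemma subplay_legal (X Y : topologicalType) (W : Type) (y : Y) (S : set W)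
    (c : W -> W) (h : W -> set (X * Y) * (X * Y)) u :
  (forall b, legal_move (h b)) -> legal_move (subplay y S c h u).
Proof.
move=> lh; rewrite /subplay; case: pselect => [e|_]; last first.
  by split => //; exact: openT.
case: (cid2 e) => b /= _ _; have [ob hb] := lh b.
by split; [exact: snd_open|exists (h b).2].
Qed.

Lemma subplay_dense (X Y : topologicalType) (W : Type) (le : rel W) (y : Y)
    (S : set W) (c : W -> W) (h : W -> set (X * Y) * (X * Y)) a :
  well_order le -> is_collapse le le S c ->
  dense_before le (subplay y S c h) (c a) <->
  forall O : set Y, open O -> O !=set0 ->
    exists2 b, below le a b & S b /\ O (h b).2.2.
Proof.
move=> wo cP; have cinj := collapse_inj wo cP.
rewrite dense_beforeP; split=> dn O oO O0.
  have [w] := dn O oO O0; rewrite -cP => -[b [Sb ba] <-].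
  by rewrite subplay_collapse//; exists b.
have [b ba [Sb Ob]] := dn O oO O0; exists (c b); first by rewrite -cP; exists b.
by rewrite subplay_collapse.
Qed.

(** A non-empty open set contains a rectangle [U `*` V] with [U] in the
    pi-basis, and the copy of [U] has put a point in [V], while its first
    coordinates lie in [U]. *)
Lemma product_dense (X Y : topologicalType) (W : Type) (le : rel W)
    (B : set (set X)) (h : W -> set (X * Y) * (X * Y)) a :
  pi_basis B -> (forall b, legal_move (h b)) ->
  (forall U, B U -> forall O : set Y, open O -> O !=set0 ->
     exists2 b, below le a b & stages h U b /\ O (h b).2.2) ->
  dense_before le h a.
Proof.
move=> [_ Bdense] lh dn; apply/dense_beforeP => O oO [[x y] Oxy].
have : nbhs (x, y) O by apply: open_nbhs_nbhs.
move=> [[P Q] /= [Px Qy] PQO].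
have [|U BU UP] := Bdense _ (open_interior P); first by exists x.
have [|b ba [bU Qb]] := dn U BU _ (open_interior Q); first by exists y.
exists b => //; apply: PQO; split; last exact: interior_subset Qb.
apply: interior_subset; apply: UP.
by rewrite -bU; exists (h b).2 => //; exact: (lh b).2.
Qed.

Lemma strategyI_local (T : topologicalType) (W : Type) (le : rel W)
    (s : strategyI T le) (u u' : W) (g g' : W -> set T * T) :
  u = u' -> (forall v, below le u v -> g v = g' v) ->
  s u (truncate g (a:=u)) = s u' (truncate g' (a:=u')).
Proof.
move=> <- gg'; congr (s u _); apply/funext => -[b bP]; apply: gg'.
exact: set_mem.
Qed.

(** The choice depends on [P] and [F] alone, hence two histories that lead to
    the same copies and the same answers lead to the same move. *)
Definition pick_move (X Z : Type) (P : set (set X)) (F : set X -> set Z) : set Z :=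
  if pselect (P !=set0) is left e then F (sval (cid e)) else setT.

Lemma pick_moveP (X Z : Type) (P : set (set X)) (F : set X -> set Z) :
  P !=set0 -> exists2 U, P U & pick_move P F = F U.
Proof.
by rewrite /pick_move; case: pselect => // e _; case: (cid e) => U /= PU; exists U.
Qed.

(** Pair the index of the fiber with the position in the fiber, and use that
    the square of an infinite [K] has the size of [K]. *)
Lemma card_le_fibers (W I K : Type) (J : set I) (f : W -> I) :
  infinite_set [set: K] -> J #<= [set: K] -> (forall a, J (f a)) ->
  (forall i, J i -> f @^-1` [set i] #<= [set: K]) ->
  [set: W] #<= [set: K].
Proof.
move=> infK JK fJ fibK; have [k0 _] := infinite_setN0 infK.
have [i iinj _] := card_le_inj k0 JK.
have /choice[g gP] : forall j,
    exists g : W -> K, J j -> {in f @^-1` [set j] &, injective g}.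
  move=> j; have [Jj|nJj] := pselect (J j); last by exists (fun=> k0).
  by have [g ginj _] := card_le_inj k0 (fibK j Jj); exists g.
apply: card_le_trans (card_square_le infK).
apply: (@inj_card_leT _ _ (fun a => (i (f a), g (f a) a))).
move=> a b _ _ [fab gab].
have {}fab : f a = f b by apply: iinj fab; exact/mem_set.
rewrite fab in gab; apply: (gP (f b) (fJ b)) gab; exact/mem_set.
Qed.

(** The copies are chosen without any bookkeeping: any unfinished copy will do,
    since a play through all stages must give one copy more than [K] stages and
    thereby turn it into a play of full length. *)
Lemma product_wins (X Y : topologicalType) (K W : Type) (le : rel W)
    (B : set (set X)) :
  infinite_set [set: K] -> succ_card_order K le ->
  pi_basis B -> B #<= [set: K] ->
  playerI_wins Y le -> playerI_wins (X * Y)%type le.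
Proof.
move=> infK sW Bpi BK [s [svalid swin]].
have [w0] := succ_card_order_inh sW; case: (sW) => wo /negP WK small.
have [[z]|] := pselect (inhabited (X * Y)); last exact: playerI_wins_empty.
have /choice[c cP] : forall S : set W, exists c, is_collapse le le S c.
  move=> S; apply: exists_collapse => // a Wa; apply: WK.
  apply: card_le_trans (small a); apply: card_le_trans Wa _.
  by apply: subset_card_le => ? [].
have cinj S := collapse_inj wo (cP S).
pose sub (h : W -> set (X * Y) * (X * Y)) U := subplay z.2 (stages h U) (c (stages h U)) h.
pose rank (h : W -> set (X * Y) * (X * Y)) U a := c (stages h U) a.
pose unfinished a h := [set U | B U /\ ~ dense_before le (sub h U) (rank h U a)].
pose answer a h U := U `*` s (rank h U a) (truncate (sub h U) (a:=rank h U a)).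
have answerP a h : (forall b, legal_move (h b)) -> ~ dense_before le h a ->
    exists2 U, unfinished a h U &
      pick_move (unfinished a h) (answer a h) = answer a h U.
  move=> lh nd; apply: pick_moveP; apply: contrapT => e; apply: nd.
  apply: (product_dense Bpi lh) => U BU; apply/(subplay_dense z.2) => //.
  by apply: contrapT => nd; apply: e; exists U.
have valid a h U : (forall b, legal_move (h b)) -> unfinished a h U ->
    open (s (rank h U a) (truncate (sub h U) (a:=rank h U a))) /\
    s (rank h U a) (truncate (sub h U) (a:=rank h U a)) !=set0.
  move=> lh [_ nd]; apply: svalid; last by rewrite ended_truncate.
  by move=> b; exact: subplay_legal.
apply: (@playerI_wins_total _ _ _ z
  (fun a h => pick_move (unfinished a h) (answer a h))) => //.
- move=> a h h' hh'.
  have SS' U : stages h U `&` below le a = stages h' U `&` below le a.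
    by rewrite predeqE => b; split=> -[Sb ba]; split=> //; move: Sb;
      rewrite /stages /= hh'.
  have rr' U : rank h U a = rank h' U a.
    exact: (collapse_local wo wo (cP _) (cP _) (SS' U)).
  have ss' U v : below le (rank h U a) v -> sub h U v = sub h' U v.
    rewrite -cP => -[b bS <-]; have [Sb ba] := bS.
    have : (stages h' U `&` below le a) b by rewrite -SS'.
    move=> [S'b _]; rewrite /sub subplay_collapse//.
    have -> : c (stages h U) b = c (stages h' U) b.
      apply: (collapse_local wo wo (cP _) (cP _)).
      rewrite predeqE => d; split=> -[Sd db]; split=> //; move: Sd;
        rewrite /stages /= hh' //; exact: (below_trans wo db ba).
    by rewrite subplay_collapse// hh'.
  congr pick_move.
    apply/funext => U; rewrite /unfinished /= -rr'.
    congr (B U /\ ~ _); rewrite /dense_before; congr (closure _ = _).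
    by apply: eq_imagel => v /ss' ->.
  apply/funext => U; rewrite /answer; congr (_ `*` _).
  by apply: strategyI_local => // v; exact: ss'.
- move=> a h lh nd; have [U Uunf ->] := answerP a h lh nd.
  have [oV [y Vy]] := valid a h U lh Uunf.
  have [oU [x Ux]] := Bpi.1 U Uunf.1.
  split; last by exists (x, y).
  rewrite openE => -[x' y'] [/= Ux' Vy'].
  by exists (U, s (rank h U a) (truncate (sub h U) (a:=rank h U a))) => //; split;
    exact: open_nbhs_nbhs.
- move=> h lh nd hP; apply: WK.
  have /choice[phi phiP] a :
      exists U, unfinished a h U /\ (h a).1 = answer a h U.
    by have [U ? ?] := answerP a h lh (nd a); exists U; rewrite hP.
  (* [phi a] is the copy picked at stage [a]. *)
  have fstE a : fst @` (h a).1 = phi a.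
    have [u ->] := phiP a; have [_ [y Vy]] := valid a h _ lh u.
    rewrite predeqE => x; split=> [[_ [? _] <-]//|px].
    by exists (x, y).
  have sndE a : snd @` (h a).1 =
      s (rank h (phi a) a) (truncate (sub h (phi a)) (a:=rank h (phi a) a)).
    have [u ->] := phiP a; have [_ [x Ux]] := Bpi.1 _ u.1.
    rewrite predeqE => y; split=> [[_ [_ ?] <-]//|py].
    by exists (x, y).
  apply: (@card_le_fibers _ _ _ B phi) => // [a|U BU]; first exact: (phiP a).1.1.
  have -> : phi @^-1` [set U] = stages h U.
    by rewrite predeqE => a; rewrite /stages /= fstE.
  have [full|[u cu]] := collapse_image wo (cP (stages h U)); last first.
    apply: card_le_trans (small u); rewrite -cu.
    by apply: inj_card_leS (@subset_refl _ _); exact: cinj.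
  (* The stages of the copy of [U] are numbered by all of K^+: the copy is
     a complete play against [s], and [s] makes it end at some stage [c b]; but
     at stage [b] the copy of [U] was picked, being unfinished. *)
  exfalso; have stageP a : stages h U a -> phi a = U by rewrite /stages /= fstE.
  have full' u : exists2 b, stages h U b & c (stages h U) b = u.
    by have : [set: W] u by []; rewrite -full => -[b]; exists b.
  have [|u] := swin (sub h U).
    move=> u _; have [b Sb <-] := full' u.
    split; last exact: (subplay_legal _ _ _ _ lh).2.
    have -> : sub h U (c (stages h U) b) = snd_move (h b).
      by apply: subplay_collapse => //; exact: cinj.
    by rewrite /= sndE (stageP b Sb).
  have [b Sb <-] := full' u; rewrite ended_truncate.
  by have [[_]] := phiP b; rewrite (stageP b Sb).
Qed.

Lemma pi_weightP (X : topologicalType) :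
  exists2 B : set (set X), pi_basis B & B #= [set: pi_weight X].
Proof.
pose P K := exists2 B : set (set X), pi_basis B & B #= [set: K].
apply: (@least_cardP P _ _).1 => [K L KL [B Bpi BK]|].
  by exists B => //; exact: card_eq_trans BK KL.
exists (set_type [set U : set X | open U /\ U !=set0]).
exists [set U : set X | open U /\ U !=set0]; last exact: card_setT_sym.
by split => // U oU U0; exists U.
Qed.

Theorem theorem2p6 (X Y : topologicalType) :
  [set: gd (X * Y)%type] #<= [set: card_max (pi_weight X) (gd Y)].
Proof.
have [[infY [V [leV [sV Ywins]]]] _] := gdP Y.
have [B Bpi /card_eqPle[BX _]] := pi_weightP X.
apply: (gdP _).2.
have [XK YK] : [set: pi_weight X] #<= [set: card_max (pi_weight X) (gd Y)] /\
    [set: gd Y] #<= [set: card_max (pi_weight X) (gd Y)].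
  rewrite /card_max; case: ifPn => [//|nXY]; split => //.
  by have [/(negP nXY)|] := card_le_total (pi_weight X) (gd Y).
move: (card_max _ _) XK YK => K XK YK.
have infK : infinite_set [set: K].
  by move/infiniteP : infY => /card_le_trans/(_ YK)/infiniteP.
split => //; have [W [le sW]] := succ_card_order_exists K; exists W, le; split => //.
apply: (product_wins infK sW Bpi (card_le_trans BX XK)).
exact: playerI_wins_le YK sV sW Ywins.
Qed.
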